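(* Let $\mathbb{E}$ and $\mathbb{F}$ be ordered vector spaces over $\mathbb{R}$, let $\kappa\ge 1$ be an integer, and let two tuples of interval operators $\boldsymbol{A}_\forall=\langle \boldsymbol{A}_1',\dots,\boldsymbol{A}_\kappa'\rangle$, $\boldsymbol{A}_\exists=\langle \boldsymbol{A}_1'',\dots,\boldsymbol{A}_\kappa''\rangle$ with $\boldsymbol{A}_i',\boldsymbol{A}_i''\in\mathbb{IL}(\mathbb{E},\mathbb{F})$ and two tuples of intervals $\boldsymbol{b}_\forall=\langle \boldsymbol{b}_1',\dots,\boldsymbol{b}_\kappa'\rangle$, $\boldsymbol{b}_\exists=\langle \boldsymbol{b}_1'',\dots,\boldsymbol{b}_\kappa''\rangle$ with $\boldsymbol{b}_i',\boldsymbol{b}_i''\in\mathbb{IF}$ ($i=1,\dots,\kappa$) be given. Assume: 1) for every $x\in\mathbb{E}$ and all $i=1,\dots,\kappa$, the sets $\boldsymbol{A}_i'x$ and $\boldsymbol{A}_i''x$ are intervals in $\mathbb{F}$; 2) the theorem on the sum of intervals holds in $\mathbb{F}$. Then $x\in\Xi_{iq}^{\kappa}(\boldsymbol{A}_\forall,\boldsymbol{A}_\exists,\boldsymbol{b}_\forall,\boldsymbol{b}_\exists)$ if and only if both of the following hold: $$\sum_{i=1}^{\kappa}\left(\boldsymbol{A}_i'x-\boldsymbol{b}_i'\right)\subseteq\sum_{i=1}^{\kappa}\left(\boldsymbol{b}_i''-\boldsymbol{A}_i''x\right),$$ $$\sum_{i=1}^{l}\mathrm{wid}(\boldsymbol{A}_i'x-\boldsymbol{b}_i')\le\sum_{i=1}^{l}\mathrm{wid}(\boldsymbol{b}_i''-\boldsymbol{A}_i''x),\qquad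 l=1,\dots,\kappa-1.$$
   Context: For an ordered vector space $\mathbb{F}$ over $\mathbb{R}$, an interval in $\mathbb{F}$ is a set $[\underline a,\overline a]=\{x\in\mathbb{F}\mid \underline a\le x\le\overline a\}$ with $\underline a,\overline a\in\mathbb{F}$, $\underline a\le\overline a$; $\mathbb{IF}$ denotes the set of all intervals in $\mathbb{F}$. $\mathbb{L}(\mathbb{E},\mathbb{F})$ is the space of linear operators from $\mathbb{E}$ to $\mathbb{F}$, preordered by the cone of positive operators ($A\le B$ iff $Ax\le Bx$ for all $x\ge 0$ in $\mathbb{E}$), and $\mathbb{IL}(\mathbb{E},\mathbb{F})$ is the set of intervals $[\underline A,\overline A]=\{A\mid\underline A\le A\le\overline A\}$, $\underline A\le\overline A$, in it (interval operators). Operations on sets: $\boldsymbol{a}+\boldsymbol{b}=\{x+y\mid x\in\boldsymbol{a},y\in\boldsymbol{b}\}$, $\boldsymbol{a}-\boldsymbol{b}=\{x-y\mid x\in\boldsymbol{a},y\in\boldsymbol{b}\}$, and $\boldsymbol{A}x=\{Ax\mid A\in\boldsymbol{A}\}$. The width of an interval $\boldsymbol{a}=[\underline a,\overline a]\in\mathbb{IF}$ is $\mathrm{wid}(\boldsymbol{a})=\overline a-\underline a\in\mathbb{F}$. ''The theorem on the sum of intervals holds in $\mathbb{F}$'' means: for all $\boldsymbol{a}=[\underline a,\overline a],\boldsymbol{b}=[\underline b,\overline b]\in\mathbb{IF}$ the sum $\boldsymbol{a}+\boldsymbol{b}$ is an interval (necessarily $\boldsymbol{a}+\boldsymbol{b}=[\underline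 a+\underline b,\overline a+\overline b]$). The solution set is $$\Xi_{iq}^{\kappa}(\boldsymbol{A}_\forall,\boldsymbol{A}_\exists,\boldsymbol{b}_\forall,\boldsymbol{b}_\exists)=\Big\{x\in\mathbb{E}\ \Big|\ (\forall A_\kappa'\in\boldsymbol{A}_\kappa')(\forall b_\kappa'\in\boldsymbol{b}_\kappa')(\exists A_\kappa''\in\boldsymbol{A}_\kappa'')(\exists b_\kappa''\in\boldsymbol{b}_\kappa'')\cdots(\forall A_1'\in\boldsymbol{A}_1')(\forall b_1'\in\boldsymbol{b}_1')(\exists A_1''\in\boldsymbol{A}_1'')(\exists b_1''\in\boldsymbol{b}_1'')\ \sum_{s=1}^{\kappa}(A_s'+A_s'')x=\sum_{s=1}^{\kappa}(b_s'+b_s'')\Big\},$$ where the quantifier blocks appear in order of decreasing index $\kappa,\kappa-1,\dots,1$ (block $\kappa$ outermost). *)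

(* Defs.v *)
From HB Require Import structures.
From mathcomp Require Import all_boot all_order all_algebra.
From mathcomp Require Import all_classical all_reals.

Set Implicit Arguments.
Unset Strict Implicit.
Unset Printing Implicit Defensive.

Import Order.TTheory GRing.Theory Num.Theory.
Local Open Scope classical_set_scope.
Local Open Scope ring_scope.

(* The order inherited from porderZmodType is a partial order not related to
   the algebraic operations; the mixin adds the two compatibility axioms. *)
HB.mixin Record Lmodule_POrder_isOrderedVector (R : numDomainType) V
    of GRing.Lmodule R V & Num.POrderedZmodule V := {
  ov_leD2r : forall x y z : V, x <= y -> x + z <= y + z;
  ov_leZ2l : forall (a : R) (x y : V), 0 <= a -> x <= y -> a *: x <= a *: y
}.

#[short(type="orderedVectType")]
HB.structure Definition OrderedVector (R : numDomainType) :=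
  {V of GRing.Lmodule R V & Num.POrderedZmodule V
        & Lmodule_POrder_isOrderedVector R V}.

Section SetArithmetic.
Variable V : zmodType.
Implicit Types X Y : set V.

Definition set_add X Y : set V := [set x + y | x in X & y in Y].
Definition set_sub X Y : set V := [set x - y | x in X & y in Y].

Definition set_sum n (X : 'I_n -> set V) : set V :=
  \big[set_add/[set 0]]_(i < n) X i.

End SetArithmetic.

Section Intervals.
Variables (R : realType) (F : orderedVectType R).

Definition intervals : set (set F) :=
  [set X | exists a b : F, a <= b /\ X = `[a, b]%classic].

(* The endpoints of an interval are unique since the order of F is
   antisymmetric; the value is 0 by convention if X is not an interval. *)
Definition wid (X : set F) : F :=
  xget 0 [set w | exists a b : F, [/\ a <= b, X = `[a, b]%classic & w = b - a]].

Lemma wid_itv (a b : F) : a <= b -> wid `[a, b]%classic = b - a.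
Proof.
move=> ab; rewrite /wid; case: xgetP => [w _ [c [d [cd E ->]]]|]; last first.
  by move=> /(_ (b - a)) []; exists a, b.
have inab x : `[a, b]%classic x = `[c, d]%classic x by rewrite E.
have /andP[ca _] : c <= a <= d.
  by move: (inab a); rewrite /= !in_itv /= lexx ab => <-.
have /andP[_ bd] : c <= b <= d.
  by move: (inab b); rewrite /= !in_itv /= lexx ab => <-.
have /andP[ac _] : a <= c <= b.
  by move: (inab c); rewrite /= !in_itv /= lexx cd => ->.
have /andP[_ db] : a <= d <= b.
  by move: (inab d); rewrite /= !in_itv /= lexx cd => ->.
have -> : a = c by apply/eqP; rewrite eq_le ac.
by have -> : b = d by apply/eqP; rewrite eq_le bd.
Qed.

Definition interval_sum_theorem : Prop :=
  forall X Y : set F, intervals X -> intervals Y -> intervals (set_add X Y).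

End Intervals.

Section IntervalOperators.
Variables (R : realType) (E F : orderedVectType R).

(* Only a preorder: the positive cone of E need not span E.  In particular the
   bounds of an interval operator need not be unique. *)
Definition op_le (A B : {linear E -> F}) : Prop :=
  forall x : E, 0 <= x -> A x <= B x.

Definition interval_operators : set (set {linear E -> F}) :=
  [set X | exists A B : {linear E -> F},
     op_le A B /\ X = [set C | op_le A C /\ op_le C B]].

Definition set_apply (X : set {linear E -> F}) (x : E) : set F :=
  [set A x | A in X].

End IntervalOperators.

(* The prefix of k alternating blocks, with the block of largest index
   outermost, in front of a condition P on the tuples of chosen values.  The
   i-th entry of each tuple (counted from 0) is the value chosen in the block
   of index i.+1. *)
Fixpoint alternating_blocks (L F : Type) (k : nat) :
    ('I_k -> set L) -> ('I_k -> set L) ->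
    ('I_k -> set F) -> ('I_k -> set F) ->
    (k.-tuple L -> k.-tuple L -> k.-tuple F -> k.-tuple F -> Prop) -> Prop :=
  match k with
  | 0 => fun _ _ _ _ P => P [tuple] [tuple] [tuple] [tuple]
  | n.+1 => fun Aall Aex ball bex P =>
      forall A', Aall ord_max A' -> forall b', ball ord_max b' ->
      exists2 A'', Aex ord_max A'' & exists2 b'', bex ord_max b'' &
      let prev T (f : 'I_n.+1 -> set T) i := f (widen_ord (leqnSn n) i) in
      alternating_blocks (prev _ Aall) (prev _ Aex) (prev _ ball) (prev _ bex)
        (fun tA' tA'' tb' tb'' =>
           P (rcons_tuple tA' A') (rcons_tuple tA'' A'')
             (rcons_tuple tb' b') (rcons_tuple tb'' b''))
  end.

Definition solution_set (R : realType) (E F : orderedVectType R) (k : nat)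
    (Aall Aex : 'I_k -> set {linear E -> F}) (ball bex : 'I_k -> set F) :
    set E :=
  [set x | alternating_blocks Aall Aex ball bex (fun A' A'' b' b'' =>
     \sum_(s < k) (tnth A' s \+ tnth A'' s) x =
     \sum_(s < k) (tnth b' s + tnth b'' s))].

(* Main.v *)
Require Import Defs.
From HB Require Import structures.
From mathcomp Require Import all_boot all_order all_algebra.
From mathcomp Require Import all_classical all_reals.

Import Order.TTheory GRing.Theory Num.Theory.
Local Open Scope classical_set_scope.
Local Open Scope ring_scope.

(* The condition only involves the residuals [A x - b].  Read from the innermost
   block outwards, the set [W l] of targets [t] for which the last [l] blocks can
   achieve [\sum_(i < l) (c i - d i) = t], with [c i] ranging over
   [[c_lo i, c_hi i]] (universally) and [d i] over [[d_lo i, d_hi i]]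
   (existentially), satisfies
     t \in W l.+1  <->  t - c \in W l - [d_lo l, d_hi l]
                        for all c \in [c_lo l, c_hi l].
   By the theorem on the sum of intervals, [W l - [d_lo l, d_hi l]] is again an
   interval as long as [W l] is nonempty, so that [W l] is the interval
     [\sum_(i < l) (c_hi i - d_hi i), \sum_(i < l) (c_lo i - d_lo i)]
   when all the intermediate ones are nonempty, which is what the inequalities
   between widths say, and is empty otherwise; the inclusion says that [0] lies
   in the outermost one. *)

(** * Order arithmetic and interval arithmetic in an ordered vector space *)

Section OrderedVectorTheory.
Context {R : realType} {F : orderedVectType R}.
Implicit Types a b c d x y : F.

Lemma ov_leD2rE c a b : (a + c <= b + c) = (a <= b).
Proof.
apply/idP/idP => [h|]; last exact: ov_leD2r.
by move: (ov_leD2r _ _ (- c) h); rewrite !addrK.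
Qed.

Lemma ov_subr_ge0 a b : (0 <= b - a) = (a <= b).
Proof. by rewrite -(ov_leD2rE a 0) add0r subrK. Qed.

Lemma ov_leD a b c d : a <= b -> c <= d -> a + c <= b + d.
Proof.
move=> ab cd; apply: (@le_trans _ _ (b + c)); first by rewrite ov_leD2rE.
by rewrite ![b + _]addrC ov_leD2rE.
Qed.

Lemma ov_leN2 a b : (- b <= - a) = (a <= b).
Proof. by rewrite -(ov_subr_ge0 (- b)) opprK addrC ov_subr_ge0. Qed.

Lemma ov_lerBlDr a b c : (a - b <= c) = (a <= c + b).
Proof. by rewrite -(ov_leD2rE b (a - b)) subrK. Qed.

Lemma ov_lerBrDr a b c : (a <= b - c) = (a + c <= b).
Proof. by rewrite -(ov_leD2rE c a) subrK. Qed.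

Lemma ov_leB a b c d : a <= b -> c <= d -> a - d <= b - c.
Proof. by move=> ab cd; apply: ov_leD; rewrite ?ov_leN2. Qed.

Lemma ov_le_subC a b c d : (a - b <= c - d) = (a - c <= b - d).
Proof. by rewrite !ov_lerBlDr addrAC [in RHS]addrAC !ov_lerBrDr [b + c]addrC. Qed.

Lemma ov_ler_sum (I : Type) (r : seq I) (P : pred I) (f g : I -> F) :
  (forall i, f i <= g i) ->
  \sum_(i <- r | P i) f i <= \sum_(i <- r | P i) g i.
Proof.
by move=> fg; apply: (big_ind2 (fun a b => a <= b)) => // *; apply: ov_leD.
Qed.

Lemma subset_itvcc a b c d : a <= b ->
  (`[a, b]%classic `<=` `[c, d]%classic) <-> (c <= a /\ b <= d).
Proof.
move=> ab; split=> [sub|[ca bd] y /=]; last first.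
  by rewrite !in_itv /= => /andP[ay yb]; rewrite (le_trans ca) ?(le_trans yb).
have := sub a; have := sub b; rewrite /= !in_itv /= !lexx ab /=.
by move=> /(_ isT)/andP[_ ->] /(_ isT)/andP[->].
Qed.

Lemma set_sub_opp (X Y : set F) : set_sub X Y = set_add X (-%R @` Y).
Proof.
apply/seteqP; split=> z /=.
  by case=> a Xa [b Yb <-]; exists a => //; exists (- b) => //; exists b.
by case=> a Xa [_ [b Yb <-] <-]; exists a => //; exists b.
Qed.

Lemma itvcc_opp a b : -%R @` `[a, b]%classic = `[- b, - a]%classic.
Proof.
apply/seteqP; split=> z /=.
  by case=> y; rewrite !in_itv /= => /andP[ay yb] <-; rewrite !ov_leN2 yb ay.
rewrite in_itv /= => /andP[bz za]; exists (- z); rewrite ?opprK//.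
by rewrite in_itv /= -ov_leN2 opprK za -ov_leN2 opprK bz.
Qed.

Hypothesis F_sum : interval_sum_theorem F.

(** [F_sum] only yields some interval [[p, q]]. Its endpoints are forced: the sum contains [a + c]
    and [b + d], and each of its elements lies between these two. *)
Lemma set_add_itvcc a b c d : a <= b -> c <= d ->
  set_add `[a, b]%classic `[c, d]%classic = `[a + c, b + d]%classic.
Proof.
move=> ab cd; have [] := F_sum `[a, b]%classic `[c, d]%classic.
- by exists a, b.
- by exists c, d.
move=> p [q [pq E]].
have [sub1 _] := subset_itvcc _ _ p q (ov_leD _ _ _ _ ab cd).
have mem u v : a <= u <= b -> c <= v <= d -> p <= u + v <= q.
  move=> hu hv; have : set_add `[a, b]%classic `[c, d]%classic (u + v).
    by exists u; rewrite /= ?in_itv //; exists v; rewrite /= ?in_itv.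
  by rewrite E /= in_itv.
rewrite E; apply/seteqP; split; last first.
  apply/(subset_itvcc _ _ _ _ (ov_leD _ _ _ _ ab cd)).
  have := mem a c; have := mem b d; rewrite !lexx ab cd /=.
  by move=> /(_ isT isT)/andP[_ ->] /(_ isT isT)/andP[->].
rewrite -E => _ [u + [v + <-]]; rewrite /= !in_itv /=.
by move=> /andP[au ub] /andP[cv vd]; rewrite !ov_leD.
Qed.

Lemma set_sub_itvcc a b c d : a <= b -> c <= d ->
  set_sub `[a, b]%classic `[c, d]%classic = `[a - d, b - c]%classic.
Proof.
by move=> ab cd; rewrite set_sub_opp itvcc_opp set_add_itvcc// ov_leN2.
Qed.

Lemma intervals_set_sub (X Y : set F) :
  intervals X -> intervals Y -> intervals (set_sub X Y).
Proof.
move=> [a [b [ab ->]]] [c [d [cd ->]]]; rewrite set_sub_itvcc//.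
by exists (a - d), (b - c); split=> //; apply: ov_leB.
Qed.

Lemma set_sum_itvcc n (f g : 'I_n -> F) : (forall i, f i <= g i) ->
  set_sum (fun i => `[f i, g i]%classic) = `[\sum_i f i, \sum_i g i]%classic.
Proof.
(* The invariant carries [a <= b] because adding the next interval requires ordered endpoints. *)
move=> fg; pose K (X : set F) a b := a <= b /\ X = `[a, b]%classic.
suff [] : K (set_sum (fun i => `[f i, g i]%classic)) (\sum_i f i) (\sum_i g i).
  by [].
apply: (big_rec3 K) => [|i X a b _ [ab ->]].
  split=> //; apply/seteqP; split=> z /=; rewrite in_itv /=.
    by move->; rewrite lexx.
  by rewrite -eq_le => /eqP.
by split; [exact: ov_leD | rewrite set_add_itvcc].
Qed.

Lemma intervals_family n (X : 'I_n -> set F) : (forall i, intervals (X i)) ->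
  exists f g : 'I_n -> F,
    (forall i, f i <= g i) /\ (forall i, X i = `[f i, g i]%classic).
Proof.
move=> X_itv; have /choice [h hP] : forall i, exists ab : F * F,
    ab.1 <= ab.2 /\ X i = `[ab.1, ab.2]%classic.
  by move=> i; have [a [b ?]] := X_itv i; exists (a, b).
by exists (fst \o h), (snd \o h); split=> i; have [] := hP i.
Qed.

(* The recursion for [W l] of the header. *)
Lemma forall_exists_itvcc (p q c_lo c_hi d_lo d_hi t : F) :
  p <= q -> c_lo <= c_hi -> d_lo <= d_hi ->
  (forall c, c_lo <= c <= c_hi -> exists2 d, d_lo <= d <= d_hi &
     p <= t - c + d <= q) <->
  p + (c_hi - d_hi) <= t <= q + (c_lo - d_lo).
Proof.
move=> pq cc dd; split=> [game|/andP[pt tq] c /andP[lc ch]].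
  apply/andP; split.
    (* The extreme moves suffice: [c_hi] with [d <= d_hi] gives the lower bound on [t], and [c_lo]
       with [d_lo <= d] the upper one. *)
    have [|d /andP[_ dh] /andP[h _]] := game c_hi; first by rewrite cc lexx.
    rewrite addrA ov_lerBlDr -ov_lerBrDr addrAC (le_trans h)//.
    by rewrite ![t - _ + _]addrC ov_leD2rE.
  have [|d /andP[ld _] /andP[_ h]] := game c_lo; first by rewrite cc lexx.
  rewrite addrA ov_lerBrDr -ov_lerBlDr addrAC (le_trans _ h)//.
  by rewrite ![t - _ + _]addrC ov_leD2rE.
(* The answer [d] has no explicit formula: it comes from splitting [t - c] as [w - d] with [w] in
   [[p, q]], which is where the theorem on sums enters. *)
have : `[p - d_hi, q - d_lo]%classic (t - c).
  rewrite /= in_itv /= ov_lerBrDr ov_lerBlDr; apply/andP; split.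
    by rewrite (le_trans _ pt)// addrAC -addrA ov_leD// ov_leB.
  by rewrite (le_trans tq)// addrAC -addrA ov_leD// ov_leB.
rewrite -set_sub_itvcc// => -[w + [d + <-]]; rewrite /= !in_itv /=.
by move=> w_itv d_itv; exists d => //; rewrite subrK.
Qed.

End OrderedVectorTheory.

(** * Last entries of tuples, prefix sums, and the induction on the number of blocks *)

Lemma tnth_rcons_widen {T n} (t : n.-tuple T) x (i : 'I_n) :
  tnth (rcons_tuple t x) (widen_ord (leqnSn n) i) = tnth t i.
Proof. by rewrite !(tnth_nth x) /= nth_rcons size_tuple ltn_ord. Qed.

Lemma tnth_rcons_max {T n} (t : n.-tuple T) x :
  tnth (rcons_tuple t x) ord_max = x.
Proof. by rewrite !(tnth_nth x) /= nth_rcons size_tuple ltnn eqxx. Qed.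

Lemma sum_prefix_recr {V : nmodType} {n} (f : 'I_n.+1 -> V) l : (l <= n)%N ->
  \sum_(i < n.+1 | (i < l)%N) f i =
  \sum_(i < n | (i < l)%N) f (widen_ord (leqnSn n) i).
Proof.
by move=> ln; rewrite big_mkcond big_ord_recr /= ltnNge ln addr0 -big_mkcond.
Qed.

Lemma sum_prefix_full {V : nmodType} {n} (f : 'I_n -> V) :
  \sum_(i < n | (i < n)%N) f i = \sum_(i < n) f i.
Proof. by apply: eq_bigl => i; rewrite ltn_ord. Qed.

(** The target [t] is arbitrary so that the induction goes through: fixing the choices of the
    outermost block leaves the same problem with one block fewer and [t] shifted by the residuals
    chosen. *)
Lemma alternating_blocks_itvcc {R : realType} {E F : orderedVectType R}
    (F_sum : interval_sum_theorem F) (x : E) n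
    (Aall Aex : 'I_n -> set {linear E -> F}) (ball bex : 'I_n -> set F)
    (c_lo c_hi d_lo d_hi : 'I_n -> F) (t : F) :
  (forall i, c_lo i <= c_hi i) -> (forall i, d_lo i <= d_hi i) ->
  (forall i, set_sub (set_apply (Aall i) x) (ball i) =
     `[c_lo i, c_hi i]%classic) ->
  (forall i, set_sub (bex i) (set_apply (Aex i) x) =
     `[d_lo i, d_hi i]%classic) ->
  alternating_blocks Aall Aex ball bex (fun A' A'' b' b'' =>
     \sum_(s < n) (tnth A' s \+ tnth A'' s) x =
     \sum_(s < n) (tnth b' s + tnth b'' s) + t) <->
  (\sum_i (c_hi i - d_hi i) <= t <= \sum_i (c_lo i - d_lo i)) /\
  (forall l, (l < n)%N ->
     \sum_(i < n | (i < l)%N) (c_hi i - d_hi i) <=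
     \sum_(i < n | (i < l)%N) (c_lo i - d_lo i)).
Proof.
elim: n Aall Aex ball bex c_lo c_hi d_lo d_hi t => [|n IHn]
  Aall Aex ball bex c_lo c_hi d_lo d_hi t cc dd Ec Ed /=.
  rewrite !big_ord0 add0r -eq_le; split=> [<-|[/eqP]//].
  by split.
set w := widen_ord (leqnSn n).
pose p := \sum_i (c_hi (w i) - d_hi (w i)).
pose q := \sum_i (c_lo (w i) - d_lo (w i)).
pose prefixes := forall l, (l < n)%N ->
  \sum_(i < n | (i < l)%N) (c_hi (w i) - d_hi (w i)) <=
  \sum_(i < n | (i < l)%N) (c_lo (w i) - d_lo (w i)).
have inner A' A'' b' b'' :
    alternating_blocks (fun i => Aall (w i)) (fun i => Aex (w i))
      (fun i => ball (w i)) (fun i => bex (w i))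
      (fun tA' tA'' tb' tb'' =>
        \sum_(s < n.+1) (tnth (rcons_tuple tA' A') s \+
                         tnth (rcons_tuple tA'' A'') s) x =
        \sum_(s < n.+1) (tnth (rcons_tuple tb' b') s +
                         tnth (rcons_tuple tb'' b'') s) + t) <->
    p <= t - (A' x - b') + (b'' - A'' x) <= q /\ prefixes.
  rewrite -(IHn _ _ _ _ _ _ _ _ _ (fun=> cc _) (fun=> dd _) (fun=> Ec _) (fun=> Ed _)).
  set P := (X in alternating_blocks _ _ _ _ X <-> _).
  set Q := (X in _ <-> alternating_blocks _ _ _ _ X).
  (* Extensional equality of the final conditions transfers the whole quantifier prefix at once. *)
  suff -> : P = Q by [].
  apply/funext=> tA'; apply/funext=> tA''; apply/funext=> tb'; apply/funext=> tb''.
  rewrite /P /Q !big_ord_recr /= !tnth_rcons_max.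
  under eq_bigr do rewrite !tnth_rcons_widen.
  under [in X in _ = X + _ + _]eq_bigr do rewrite !tnth_rcons_widen.
  set S := \sum_(i < n) _; set T := \sum_(i < n) _.
  have -> : t - (A' x - b') + (b'' - A'' x) = b' + b'' + t - (A' x + A'' x).
    by rewrite opprB opprD -addrA [b' - _ + _]addrACA addrA [t + _]addrC.
  apply/propext; split=> [h|->]; last by rewrite -addrA subrK !addrA.
  by apply: (addIr (A' x + A'' x)); rewrite h -[RHS]addrA subrK !addrA.
have -> : (\sum_(i < n.+1) (c_hi i - d_hi i) <= t
          <= \sum_(i < n.+1) (c_lo i - d_lo i)) =
    (p + (c_hi ord_max - d_hi ord_max) <= t
     <= q + (c_lo ord_max - d_lo ord_max)) by rewrite !big_ord_recr.
(* The new inequality, at [l = n], is [p <= q], the nonemptiness of [W n]. *)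
have prefE : (forall l, (l < n.+1)%N ->
    \sum_(i < n.+1 | (i < l)%N) (c_hi i - d_hi i) <=
    \sum_(i < n.+1 | (i < l)%N) (c_lo i - d_lo i)) <-> p <= q /\ prefixes.
  split=> [pref|[pq pref] l].
    split=> [|l ln].
      by have := pref n (leqnn _); rewrite !sum_prefix_recr// !sum_prefix_full.
    by have := pref l (leqW ln); rewrite !sum_prefix_recr// ltnW.
  rewrite ltnS => ln; rewrite !sum_prefix_recr//.
  by move: ln; rewrite leq_eqVlt => /orP[/eqP->|/pref//]; rewrite !sum_prefix_full.
rewrite prefE.
(* The choices matter only through the residuals [c = A' x - b'] and [d = b'' - A'' x]. *)
have blockE : (forall A', Aall ord_max A' -> forall b', ball ord_max b' ->
      exists2 A'', Aex ord_max A'' & exists2 b'', bex ord_max b'' &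
      p <= t - (A' x - b') + (b'' - A'' x) <= q /\ prefixes) <->
    (forall c, c_lo ord_max <= c <= c_hi ord_max ->
      exists2 d, d_lo ord_max <= d <= d_hi ord_max &
      p <= t - c + d <= q /\ prefixes).
  have memc c : (c_lo ord_max <= c <= c_hi ord_max) =
      set_sub (set_apply (Aall ord_max) x) (ball ord_max) c :> Prop.
    by rewrite Ec /= in_itv.
  have memd d : (d_lo ord_max <= d <= d_hi ord_max) =
      set_sub (bex ord_max) (set_apply (Aex ord_max) x) d :> Prop.
    by rewrite Ed /= in_itv.
  split=> [game c|game A' A'P b' b'P].
    rewrite memc => -[_ [A' A'P <-] [b' b'P <-]].
    have [A'' A''P [b'' b''P res]] := game A' A'P b' b'P.
    exists (b'' - A'' x) => //; rewrite memd.
    by exists b'' => //; exists (A'' x) => //; exists A''.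
  have [|d] := game (A' x - b').
    by rewrite memc; exists (A' x); [exists A' | exists b'].
  rewrite memd => -[b'' b''P [_ [A'' A''P <-] <-]] res.
  by exists A'' => //; exists b''.
have -> : (forall A', Aall ord_max A' -> forall b', ball ord_max b' ->
      exists2 A'', Aex ord_max A'' & exists2 b'', bex ord_max b'' &
      alternating_blocks (fun i => Aall (w i)) (fun i => Aex (w i))
      (fun i => ball (w i)) (fun i => bex (w i))
      (fun tA' tA'' tb' tb'' =>
        \sum_(s < n.+1) (tnth (rcons_tuple tA' A') s \+
                         tnth (rcons_tuple tA'' A'') s) x =
        \sum_(s < n.+1) (tnth (rcons_tuple tb' b') s +
                         tnth (rcons_tuple tb'' b'') s) + t)) <->
    (forall A', Aall ord_max A' -> forall b', ball ord_max b' ->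
      exists2 A'', Aex ord_max A'' & exists2 b'', bex ord_max b'' &
      p <= t - (A' x - b') + (b'' - A'' x) <= q /\ prefixes).
  by split=> game A' A'P b' /(game A' A'P b')[A'' ? [b'' ? /inner res]];
    exists A'' => //; exists b''.
rewrite blockE; split=> [game|[bnd [pq pref]]].
  (* Neither [prefixes] nor [p <= q] depends on [c], so playing one admissible [c] extracts both. *)
  have [|d _ [/andP[pt tq] pref]] := game (c_lo ord_max).
    by rewrite lexx cc.
  have pq := le_trans pt tq.
  split=> //; apply/(forall_exists_itvcc F_sum _ _ _ _ _ _ _ pq (cc _) (dd _)).
  by move=> c /game[d' ? []]; exists d'.
move/(forall_exists_itvcc F_sum _ _ _ _ _ _ _ pq (cc _) (dd _)): bnd => game c /game.
by case=> d ? ?; exists d.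
Qed.

Theorem mainTheorem1 (R : realType) (E F : orderedVectType R) (k : nat)
    (k_ge1 : (1 <= k)%N)
    (Aall Aex : 'I_k -> set {linear E -> F}) (ball bex : 'I_k -> set F)
    (Aall_itv : forall i, interval_operators (Aall i))
    (Aex_itv : forall i, interval_operators (Aex i))
    (ball_itv : forall i, intervals (ball i))
    (bex_itv : forall i, intervals (bex i))
    (Ax_itv : forall (x : E) (i : 'I_k),
        intervals (set_apply (Aall i) x) /\ intervals (set_apply (Aex i) x))
    (F_sum : interval_sum_theorem F)
    (x : E) :
  solution_set Aall Aex ball bex x <->
  (set_sum (fun i => set_sub (set_apply (Aall i) x) (ball i)) `<=`
   set_sum (fun i => set_sub (bex i) (set_apply (Aex i) x))) /\
  (forall l : nat, (1 <= l <= k - 1)%N ->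
     \sum_(i < k | (i < l)%N) wid (set_sub (set_apply (Aall i) x) (ball i)) <=
     \sum_(i < k | (i < l)%N) wid (set_sub (bex i) (set_apply (Aex i) x))).
Proof.
have [c_lo [c_hi [cc Ec]]] := intervals_family _ _
  (fun i => intervals_set_sub F_sum _ _ (Ax_itv x i).1 (ball_itv i)).
have [d_lo [d_hi [dd Ed]]] := intervals_family _ _
  (fun i => intervals_set_sub F_sum _ _ (bex_itv i) (Ax_itv x i).2).
have -> : set_sum (fun i => set_sub (set_apply (Aall i) x) (ball i)) =
    `[\sum_i c_lo i, \sum_i c_hi i]%classic.
  by rewrite -set_sum_itvcc//; congr set_sum; apply/funext.
have -> : set_sum (fun i => set_sub (bex i) (set_apply (Aex i) x)) =
    `[\sum_i d_lo i, \sum_i d_hi i]%classic.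
  by rewrite -set_sum_itvcc//; congr set_sum; apply/funext.
rewrite subset_itvcc; last exact: ov_ler_sum.
(* Exchanging [c_lo] and [d_hi] across the inequality turns comparison of widths into nonemptiness
   of [W l]. *)
have widE l : (\sum_(i < k | (i < l)%N)
      wid (set_sub (set_apply (Aall i) x) (ball i)) <=
    \sum_(i < k | (i < l)%N) wid (set_sub (bex i) (set_apply (Aex i) x))) =
    (\sum_(i < k | (i < l)%N) (c_hi i - d_hi i) <=
     \sum_(i < k | (i < l)%N) (c_lo i - d_lo i)).
  under eq_bigr do rewrite Ec wid_itv//.
  under [in leRHS]eq_bigr do rewrite Ed wid_itv//.
  by rewrite !sumrB ov_le_subC.
have -> : solution_set Aall Aex ball bex x <->
    alternating_blocks Aall Aex ball bex (fun A' A'' b' b'' =>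
     \sum_(s < k) (tnth A' s \+ tnth A'' s) x =
     \sum_(s < k) (tnth b' s + tnth b'' s) + 0).
  set P := (X in _ <-> alternating_blocks _ _ _ _ X).
  rewrite /solution_set /=; set Q := (X in alternating_blocks _ _ _ _ X).
  suff -> : Q = P by [].
  apply/funext=> A'; apply/funext=> A''; apply/funext=> b'; apply/funext=> b''.
  by rewrite /P addr0.
rewrite (alternating_blocks_itvcc F_sum _ _ _ _ _ _ _ _ _ _ _ cc dd Ec Ed).
(* With target [0], the bounds on [t] become the two endpoint inequalities of the inclusion. *)
rewrite !sumrB ov_lerBlDr add0r ov_subr_ge0.
split=> [[/andP[-> ->] pref]|[[-> ->] pref]]; split=> // l.
  by case/andP=> _ lk; rewrite widE; apply: pref; rewrite -(subnK k_ge1) addn1 ltnS.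
(* The width conditions start at [l = 1]; at [l = 0] both sums are empty. *)
case: l => [|l] lk; first by rewrite !big_pred0.
by rewrite -widE; apply: pref; rewrite leq_subRL// add1n.
Qed.
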